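(* A binary algebra $(Q,\cdot)$ is a medial quandle if and only if it is the sum of an indecomposable affine mesh $(A_i;\varphi_{i,j};c_{i,j})$ over some non-empty set $I$. Moreover, the orbits of the quandle coincide with the groups of the mesh, i.e., if $Q$ is the sum of an indecomposable affine mesh $(A_i;\varphi_{i,j};c_{i,j})$ over $I$, then the orbits of $Q$ are precisely the (underlying sets of the) groups $A_i$, $i\in I$.
   Context: A binary algebra is a non-empty set with one binary operation. A quandle is a binary algebra $(Q,\cdot)$ such that for all $x,y,z$: $xx=x$; $x(yz)=(xy)(xz)$; and the equation $xu=y$ has a unique solution $u\in Q$. It is medial if $(xy)(uv)=(xu)(yv)$ for all $x,y,u,v\in Q$. The left translation by $a$ is $L_a:Q\to Q$, $x\mapsto ax$ (a permutation when $Q$ is a quandle). $\mathrm{LMlt}(Q)$ is the group of permutations of $Q$ generated by all $L_a$, $a\in Q$. The orbits of $Q$ are the orbits of the natural action of $\mathrm{LMlt}(Q)$ on $Q$. An affine mesh over a non-empty set $I$ is a triple $((A_i)_{i\in I},(\varphi_{i,j})_{i,j\in I},(c_{i,j})_{i,j\in I})$, written $(A_i;\varphi_{i,j};c_{i,j})$, where $A_i$ are abelian groups, $\varphi_{i,j}:A_i\to A_j$ are homomorphisms and $c_{i,j}\in A_j$ are constants, such that for all $i,j,j',k\in I$: (M1) $1-\varphi_{i,i}$ is an automorphism of $A_i$ (where $1$ is the identity map); (M2) $c_{i,i}=0$; (M3) $\varphi_{j,k}\varphi_{i,j}=\varphi_{j',k}\varphi_{i,j'}$; (M4) $\varphi_{j,k}(c_{i,j})=\varphi_{k,k}(c_{i,k}-c_{j,k})$.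 The mesh is indecomposable if for every $j\in I$ the group $A_j$ is generated by $\bigcup_{i\in I}(c_{i,j}+\mathrm{Im}(\varphi_{i,j}))$. The sum of an affine mesh $(A_i;\varphi_{i,j};c_{i,j})$ over $I$ is the binary algebra on the disjoint union of the sets $A_i$ with operation $a*b=c_{i,j}+\varphi_{i,j}(a)+(1-\varphi_{j,j})(b)$ for $a\in A_i$, $b\in A_j$. *)

(* Defs.v *)
From HB Require Import structures.
From mathcomp Require Import all_boot all_algebra.
From mathcomp Require Import classical_sets.

Set Implicit Arguments.
Unset Strict Implicit.
Unset Printing Implicit Defensive.

Import GRing.Theory.
Local Open Scope classical_set_scope.
Local Open Scope ring_scope.

(* A binary algebra is a carrier Q with an operation op : Q -> Q -> Q; its
   non-emptiness is a hypothesis "inhabited Q" where it matters. *)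

Definition quandle (Q : Type) (op : Q -> Q -> Q) : Prop :=
  [/\ forall x, op x x = x,
      forall x y z, op x (op y z) = op (op x y) (op x z)
    & forall x y, exists! u, op x u = y].

Definition medial (Q : Type) (op : Q -> Q -> Q) : Prop :=
  forall x y u v, op (op x y) (op u v) = op (op x u) (op y v).

Definition medial_quandle (Q : Type) (op : Q -> Q -> Q) : Prop :=
  quandle op /\ medial op.

Definition left_translation (Q : Type) (op : Q -> Q -> Q) (a : Q) : Q -> Q :=
  fun x => op a x.

Definition permutation_group (Q : Type) (G : set (Q -> Q)) : Prop :=
  [/\ forall g, G g -> bijective g,
      G id,
      forall g h, G g -> G h -> G (g \o h)
    & forall g h, G g -> cancel g h -> cancel h g -> G h].

(* The smallest permutation group containing all the L_a. It is meaningful only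
   when every L_a is a permutation, as in a quandle: otherwise no permutation
   group contains them and the intersection is all of Q -> Q. *)
Definition LMlt (Q : Type) (op : Q -> Q -> Q) : set (Q -> Q) :=
  smallest (@permutation_group Q) (range (left_translation op)).

Definition orbit_of (Q : Type) (op : Q -> Q -> Q) (x : Q) : set Q :=
  [set g x | g in LMlt op].

Definition orbits (Q : Type) (op : Q -> Q -> Q) : set (set Q) :=
  range (orbit_of op).

(* Every abelian group is classically a zmodType, so nothing is lost by taking
   the groups of a mesh there. *)
Record affine_mesh (I : Type) := AffineMesh {
  mesh_grp : I -> zmodType;
  mesh_hom : forall i j, {additive mesh_grp i -> mesh_grp j};
  mesh_cst : forall i j, mesh_grp j;
  mesh_index_nonempty : inhabited I;
  mesh_M1 : forall i,
    bijective (fun a : mesh_grp i => a - mesh_hom i i a);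
  mesh_M2 : forall i, mesh_cst i i = 0;
  mesh_M3 : forall i j j' k (a : mesh_grp i),
    mesh_hom j k (mesh_hom i j a) = mesh_hom j' k (mesh_hom i j' a);
  mesh_M4 : forall i j k,
    mesh_hom j k (mesh_cst i j) =
    mesh_hom k k (mesh_cst i k - mesh_cst j k)
}.

Definition subgroup (V : zmodType) (H : set V) : Prop :=
  H 0 /\ forall u v, H u -> H v -> H (u - v).

Definition generated_subgroup (V : zmodType) (S : set V) : set V :=
  smallest (@subgroup V) S.

Definition indecomposable (I : Type) (M : affine_mesh I) : Prop :=
  forall j : I,
    generated_subgroup
      (\bigcup_i range (fun a : mesh_grp M i => mesh_cst M i j + mesh_hom M i j a))
    = [set: mesh_grp M j].

Definition mesh_sum (I : Type) (M : affine_mesh I) : Type :=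
  {i : I & mesh_grp M i}.

Definition mesh_sum_op (I : Type) (M : affine_mesh I) (x y : mesh_sum M) :
    mesh_sum M :=
  let: existT i a := x in
  let: existT j b := y in
  existT _ j (mesh_cst M i j + mesh_hom M i j a + (b - mesh_hom M j j b)).

Definition mesh_component (I : Type) (M : affine_mesh I) (i : I) :
    set (mesh_sum M) :=
  range (fun a : mesh_grp M i => existT _ i a).
Arguments mesh_component {I} M i _.

(* "(Q, op) is the sum of M" is read up to isomorphism: f identifies the
   disjoint union of the groups of M with Q. *)
Definition sum_isomorphism (I : Type) (M : affine_mesh I) (Q : Type)
    (op : Q -> Q -> Q) (f : mesh_sum M -> Q) : Prop :=
  bijective f /\ forall x y, f (mesh_sum_op x y) = op (f x) (f y).

(* Main.v *)
Require Import Defs.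
From HB Require Import structures.
From mathcomp Require Import all_boot all_algebra.
From mathcomp Require Import boolp classical_sets.
Local Open Scope classical_set_scope.

(** The translations of a medial quandle differ by permutations L_a L_b^-1,
    and mediality says exactly that these commute.  They generate an abelian
    group D, the displacement group, written additively below; it acts on Q
    with the same orbits as the group of all left translations.

    Two pieces of linear algebra over D describe the whole operation.  Write
    [delta a b] for L_a L_b^-1, and [kappa] for conjugation by L_a on D, which
    does not depend on a because D is abelian.  Then [delta] is a cocycle
    ([delta_chain]), and, since the elements of D are automorphisms,
    delta (alpha x) x = alpha - kappa alpha =: [eps] alpha ([delta_act]).
    Hence, for any points e and e',

      (alpha e)(beta e') = (delta e e' + eps alpha + (beta - eps beta)) e'.

    As D is abelian, the orbit of e is a quotient of D, so it is an abelian
    group with zero e.  Choosing one point e_i in each orbit, the formula says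
    that Q is the sum of the mesh formed by the orbits of the e_i, the
    homomorphisms alpha e_i |-> (eps alpha) e_j and the constants
    (delta e_i e_j) e_j.  Their values are all written with one group D, so (M3)
    and (M4) become identities between eps and delta.  Indecomposability holds
    because the generators delta a b = delta a e_j - delta b e_j of D
    send e_j to differences of the elements a e_j of the mesh condition.

    Conversely, the sum of a mesh is a medial quandle by calculation.  Its left
    translations preserve every A_j.  If a is in A_i and 0 is the zero of A_j,
    then L_a L_0^-1 acts on A_j as the addition of c_ij + phi_ij a; so
    indecomposability makes every addition of A_j available in the left
    multiplication group ([LMlt_translation]), and A_j is a single orbit. *)

Set Implicit Arguments.
Unset Strict Implicit.
Unset Printing Implicit Defensive.

Import GRing.Theory.

(** * Permutation groups *)

Section PermutationGroups.
Variable Q : Type.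
Implicit Types (S P : set (Q -> Q)) (g h : Q -> Q).

Lemma bijective_can2 g : bijective g -> exists h, cancel g h /\ cancel h g.
Proof. by case=> h gK hK; exists h. Qed.

Lemma inj_surj_bij (T U : Type) (f : T -> U) :
  injective f -> (forall y, exists x, f x = y) -> bijective f.
Proof.
move=> f_inj f_surj; pose g y := sval (cid (f_surj y)).
have gK y : f (g y) = y by exact: svalP (cid (f_surj y)).
by exists g => // x; apply: f_inj; rewrite gK.
Qed.

Lemma generated_permutation_ind S P :
    (forall g, S g -> bijective g) ->
    S `<=` P -> P id -> (forall g h, P g -> P h -> P (g \o h)) ->
    (forall g h, P g -> cancel g h -> cancel h g -> P h) ->
  smallest (@permutation_group Q) S `<=` P.
Proof.
move=> S_bij SP P1 PM PV g Sg.
suff /Sg [] : permutation_group [set g | bijective g /\ P g] /\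
              S `<=` [set g | bijective g /\ P g] by [].
split; last by move=> s Ss; split; [exact: S_bij | exact: SP].
split=> [s [] // | | s t [sb Ps] [tb Pt] | s t [sb Ps] sK tK].
- by split=> //; exists id.
- by split; [exact: bij_comp | exact: PM].
- by split; [exists s | exact: PV Ps sK tK].
Qed.

(** Bijectivity of the generators is what makes some permutation group contain
    them, hence what makes the intersection consist of permutations. *)
Lemma generated_permutation_group S :
    (forall g, S g -> bijective g) ->
  permutation_group (smallest (@permutation_group Q) S).
Proof.
move=> S_bij; split=> [||g h Gg Gh M MG|g h Gg gK hK M MG].
- apply: generated_permutation_ind => //; first by exists id.
  + exact: bij_comp.
  + by move=> g h _ gK hK; exists g.
- by move=> M [[]].
- by case: (MG) => -[_ _ MM _] _; apply: MM; [exact: Gg | exact: Gh].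
- by case: (MG) => -[_ _ _ MV] _; apply: MV gK hK; exact: Gg.
Qed.

Lemma generated_permutation_comm S :
    (forall g, S g -> bijective g) ->
    (forall g h, S g -> S h -> g \o h = h \o g) ->
  forall g h, smallest (@permutation_group Q) S g ->
    smallest (@permutation_group Q) S h -> g \o h = h \o g.
Proof.
move=> S_bij S_comm.
(* passing to the centralizer preserves generation, so it is applied twice *)
have centr P : (forall g h, S g -> P h -> g \o h = h \o g) ->
    forall g h, smallest (@permutation_group Q) S g -> P h -> g \o h = h \o g.
  move=> SP g h Sg Ph; move: g Sg.
  apply: generated_permutation_ind => //.
  - by move=> s Ss; exact: SP.
  - by move=> s t sh th; rewrite -compA [t \o h]th compA sh.
  - move=> s t /funeqP sh sK tK; apply/funext => x /=.
    by rewrite -{1}[x]tK -[h (s (t x))]sh /= sK.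
apply: (centr _) => g h Sg Gh; apply/esym; apply: (centr _ _ _ _ Gh Sg).
exact: S_comm.
Qed.

End PermutationGroups.

(** * Building abelian groups *)

Section AbelianGroupOf.
Variables (T : Type) (add : T -> T -> T) (opp : T -> T) (zero : T).
Hypotheses (addA : associative add) (addC : commutative add).
Hypotheses (add0 : left_id zero add) (addN : left_inverse zero opp add).

Let T_choice : choiceType := HB.pack T (gen_eqMixin T) (gen_choiceMixin T).

Definition abelian_group_of : zmodType :=
  HB.pack T (Choice.on T_choice)
    (GRing.isZmodule.Build T_choice addA addC add0 addN).

End AbelianGroupOf.

Lemma sval_inj (T : Type) (P : T -> Prop) : injective (@proj1_sig T P).
Proof. by move=> u v; apply: eq_sig_hprop => *; exact: Prop_irrelevance. Qed.

Section AbelianPermutationGroup.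
Variables (Q : Type) (G : set (Q -> Q)).
Hypotheses (G_group : permutation_group G).
Hypothesis (G_comm : forall g h, G g -> G h -> g \o h = h \o g).
Implicit Types u v : {g | G g}.

Definition perm_comp u v : {g | G g} :=
  let: And4 _ _ GM _ := G_group in
  exist G (sval u \o sval v) (GM _ _ (svalP u) (svalP v)).

Definition perm_id : {g | G g} :=
  let: And4 _ G1 _ _ := G_group in exist G id G1.

Lemma perm_inv_subproof u :
  exists v, cancel (sval u) (sval v) /\ cancel (sval v) (sval u).
Proof.
case: u => g Gg /=; case: G_group => G_bij _ _ GV.
have [h [gK hK]] := bijective_can2 (G_bij g Gg).
by exists (exist G h (GV g h Gg gK hK)).
Qed.

Definition perm_inv u := sval (cid (perm_inv_subproof u)).

Lemma sval_perm_comp u v : sval (perm_comp u v) = sval u \o sval v.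
Proof. by rewrite /perm_comp; case: G_group. Qed.

Lemma sval_perm_id : sval perm_id = id.
Proof. by rewrite /perm_id; case: G_group. Qed.

Lemma perm_compA : associative perm_comp.
Proof. by move=> u v w; apply: sval_inj; rewrite !sval_perm_comp. Qed.

Lemma perm_compC : commutative perm_comp.
Proof.
move=> u v; apply: sval_inj; rewrite !sval_perm_comp.
by apply: G_comm; exact: svalP.
Qed.

Lemma perm_comp_id : left_id perm_id perm_comp.
Proof. by move=> u; apply: sval_inj; rewrite sval_perm_comp sval_perm_id. Qed.

Lemma perm_comp_inv : left_inverse perm_id perm_inv perm_comp.
Proof.
move=> u; apply: sval_inj; rewrite sval_perm_comp sval_perm_id.
by apply/funext => x /=; case: (svalP (cid (perm_inv_subproof u))).
Qed.

Definition perm_zmodType : zmodType :=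
  abelian_group_of perm_compA perm_compC perm_comp_id perm_comp_inv.

End AbelianPermutationGroup.

Section QuotientGroup.
Local Open Scope ring_scope.
Variables (D : zmodType) (X : Type) (p : D -> X).
Hypothesis p_surj : forall x, exists a, p a = x.
Hypothesis p_compat : forall a a' b, p a = p a' -> p (a + b) = p (a' + b).

Definition quot_repr x := sval (cid (p_surj x)).

Lemma quot_reprK x : p (quot_repr x) = x.
Proof. exact: svalP (cid (p_surj x)). Qed.

Definition quot_add x y := p (quot_repr x + quot_repr y).
Definition quot_opp x := p (- quot_repr x).

Lemma quot_addE a b : quot_add (p a) (p b) = p (a + b).
Proof.
rewrite /quot_add (p_compat _ (quot_reprK (p a))) addrC.
by rewrite (p_compat _ (quot_reprK (p b))) addrC.
Qed.

Lemma quot_addA : associative quot_add.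
Proof.
move=> x y z; rewrite -[x]quot_reprK -[y]quot_reprK -[z]quot_reprK.
by rewrite !quot_addE addrA.
Qed.

Lemma quot_addC : commutative quot_add.
Proof. by move=> x y; rewrite /quot_add addrC. Qed.

Lemma quot_add0 : left_id (p 0) quot_add.
Proof. by move=> x; rewrite -[x]quot_reprK quot_addE add0r. Qed.

Lemma quot_addN : left_inverse (p 0) quot_opp quot_add.
Proof.
by move=> x; rewrite -{2}[x]quot_reprK /quot_opp quot_addE addNr.
Qed.

Definition quot_zmodType : zmodType :=
  abelian_group_of quot_addA quot_addC quot_add0 quot_addN.

Lemma quot_projD a b : p (a + b) = (p a : quot_zmodType) + (p b : quot_zmodType).
Proof. by rewrite -quot_addE. Qed.

Lemma quot_projB a b : p (a - b) = (p a : quot_zmodType) - (p b : quot_zmodType).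
Proof.
by apply: (@addIr quot_zmodType (p b)); rewrite subrK -quot_projD subrK.
Qed.

End QuotientGroup.

(** * The displacement group of a medial quandle *)

Section Displacements.
Local Open Scope ring_scope.
Variables (Q : Type) (op : Q -> Q -> Q).
Hypothesis op_mq : medial_quandle op.

Lemma opxx x : op x x = x.
Proof. by case: op_mq => -[]. Qed.

Lemma op_distl x y z : op x (op y z) = op (op x y) (op x z).
Proof. by case: op_mq => -[]. Qed.

Lemma op_medial x y u v : op (op x y) (op u v) = op (op x u) (op y v).
Proof. by case: op_mq. Qed.

Lemma ldiv_subproof x y : exists u, op x u = y /\ forall v, op x v = y -> u = v.
Proof. by case: op_mq => -[_ _ /(_ x y)]. Qed.

Definition ldiv x y := sval (cid (ldiv_subproof x y)).

Lemma ldivK x : cancel (ldiv x) (op x).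
Proof. by move=> y; case: (svalP (cid (ldiv_subproof x y))). Qed.

Lemma opK x : cancel (op x) (ldiv x).
Proof. by move=> y; case: (svalP (cid (ldiv_subproof x (op x y)))) => _; apply. Qed.

Lemma op_inj x : injective (op x).
Proof. exact: can_inj (opK x). Qed.

Definition displace a b : Q -> Q := fun x => op a (ldiv b x).

Definition displacements : set (Q -> Q) :=
  smallest (@permutation_group Q) [set g | exists a b, g = displace a b].

Lemma displaceK a b : cancel (displace a b) (displace b a).
Proof. by move=> x; rewrite /displace opK ldivK. Qed.

Lemma displace_bij g : (exists a b, g = displace a b) -> bijective g.
Proof. by move=> [a [b ->]]; exists (displace b a); exact: displaceK. Qed.

Lemma displacements_group : permutation_group displacements.
Proof. exact: generated_permutation_group displace_bij. Qed.

Lemma displacements_displace a b : displacements (displace a b).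
Proof. by apply: sub_gen_smallest; exists a, b. Qed.

(** Applying L_b distributes it over both sides and turns
    L_a L_b^-1 L_c = L_c L_b^-1 L_a into the medial law. *)
Lemma op_ldiv_op_exchange a b c x : op a (ldiv b (op c x)) = op c (ldiv b (op a x)).
Proof. by apply: (@op_inj b); rewrite op_distl ldivK [RHS]op_distl ldivK op_medial. Qed.

Lemma ldiv_op_ldiv_exchange a b c x :
  ldiv a (op b (ldiv c x)) = ldiv c (op b (ldiv a x)).
Proof.
set y := RHS; have x_y : op c (ldiv b (op a y)) = x.
  by rewrite op_ldiv_op_exchange /y ldivK opK ldivK.
by rewrite -x_y opK ldivK opK.
Qed.

Lemma displacements_comm g h :
  displacements g -> displacements h -> g \o h = h \o g.
Proof.
apply: generated_permutation_comm; first exact: displace_bij.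
move=> _ _ [a [b ->]] [c [d ->]]; apply/funext => x /=; rewrite /displace.
by rewrite op_ldiv_op_exchange ldiv_op_ldiv_exchange.
Qed.

Definition Dis : zmodType := perm_zmodType displacements_group displacements_comm.

Definition act (al : Dis) (x : Q) : Q := (sval al : Q -> Q) x.

Lemma actD al be x : act (al + be) x = act al (act be x).
Proof. by rewrite /act [sval _]sval_perm_comp. Qed.

Lemma act0 x : act 0 x = x.
Proof. by rewrite /act [sval _]sval_perm_id. Qed.

Lemma actNK al : cancel (act al) (act (- al)).
Proof. by move=> x; rewrite -actD addNr act0. Qed.

(** Every point has the form b y, so a displacement is known by its values
    there; this is the form in which displacements are computed below. *)
Lemma act_op_inj b al be :
  (forall y, act al (op b y) = act be (op b y)) -> al = be.
Proof.
move=> eq_ab; apply: sval_inj; apply/funext => x.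
by have := eq_ab (ldiv b x); rewrite ldivK.
Qed.

Definition delta a b : Dis := exist displacements _ (displacements_displace a b).

Lemma delta_op a b y : act (delta a b) (op b y) = op a y.
Proof. by rewrite /act /= /displace opK. Qed.

Lemma delta_chain a b c : delta a b + delta b c = delta a c.
Proof. by apply: (@act_op_inj c) => y; rewrite actD !delta_op. Qed.

Lemma delta_xx a : delta a a = 0.
Proof. by apply: (@act_op_inj a) => y; rewrite delta_op act0. Qed.

Lemma act_automorphism al x y : act al (op x y) = op (act al x) (act al y).
Proof.
rewrite /act; case: al => /= g Dg; move: g Dg x y.
apply: generated_permutation_ind => //=; first exact: displace_bij.
- move=> _ [a [b ->]] x y; rewrite /displace -op_distl; congr op.
  by apply: (@op_inj b); rewrite op_distl !ldivK.
- by move=> g h gM hM x y /=; rewrite hM gM.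
- by move=> g h gM gK hK x y; rewrite -{1}[x]hK -{1}[y]hK -gM gK.
Qed.

Lemma displacements_conj a g :
  displacements g -> displacements (fun x => op a (g (ldiv a x))).
Proof.
case: displacements_group => _ D1 DM DV; move: g.
apply: generated_permutation_ind => /=; first exact: displace_bij.
- move=> _ [b [c ->]] /=.
  have -> : (fun x => op a (displace b c (ldiv a x))) =
      displace (op a b) (op a c).
    apply/funext => x; rewrite /displace op_distl; congr op.
    by apply: (@op_inj (op a c)); rewrite -op_distl !ldivK.
  exact: displacements_displace.
- have -> : (fun x => op a (ldiv a x)) = id by apply/funext => x; rewrite ldivK.
  exact: D1.
- move=> g h Dg Dh.
  have -> : (fun x => op a (g (h (ldiv a x)))) =
      (fun x => op a (g (ldiv a x))) \o (fun x => op a (h (ldiv a x))).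
    by apply/funext => x /=; rewrite opK.
  exact: DM.
- move=> g h Dg gK hK; apply: DV Dg _ _ => x; first by rewrite opK gK ldivK.
  by rewrite opK hK ldivK.
Qed.

(** * Conjugation of displacements, and their orbits as abelian groups *)

(** The base point only serves to define [kappa]; see [kappa_op]. *)
Variable q0 : Q.

Definition kappa (al : Dis) : Dis :=
  exist displacements _ (displacements_conj q0 (svalP al)).

(** Conjugating by L_b instead of L_q0 changes nothing, because L_b L_q0^-1 is
    a displacement and displacements commute. *)
Lemma kappa_op al b y : act (kappa al) (op b y) = op b (act al y).
Proof.
have kappa_q0 : act (kappa al) (op q0 y) = op q0 (act al y).
  by rewrite /act /= opK.
by rewrite -[op b y](delta_op b q0) -actD addrC actD kappa_q0 delta_op.
Qed.

Lemma kappaD al be : kappa (al + be) = kappa al + kappa be.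
Proof. by apply: (@act_op_inj q0) => y; rewrite actD !kappa_op actD. Qed.

Definition eps (al : Dis) : Dis := al - kappa al.

Lemma epsD al be : eps (al + be) = eps al + eps be.
Proof. by rewrite /eps kappaD opprD addrACA. Qed.

(** As alpha is an automorphism, L_(alpha x) is the conjugate of L_x by alpha;
    so L_(alpha x) L_x^-1 is the commutator of alpha and L_x. *)
Lemma delta_act al x : delta (act al x) x = eps al.
Proof.
apply: (addIr (kappa al)); rewrite subrK; apply: (@act_op_inj x) => y.
by rewrite actD kappa_op delta_op act_automorphism.
Qed.

Definition dis_orbit (e : Q) : Type := {x | exists al, act al e = x}.

Definition dis_pt (e : Q) (al : Dis) : dis_orbit e :=
  exist _ (act al e) (ex_intro _ al erefl).

Lemma dis_pt_surj e (x : dis_orbit e) : exists al, dis_pt e al = x.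
Proof. by case: x => x [al alx]; exists al; apply: sval_inj. Qed.

Lemma dis_pt_compat e al al' be :
  dis_pt e al = dis_pt e al' -> dis_pt e (al + be) = dis_pt e (al' + be).
Proof.
move=> /(congr1 sval) /= eq_al; apply: sval_inj => /=.
by rewrite ![_ + be]addrC !actD eq_al.
Qed.

Definition orbit_zmodType (e : Q) : zmodType :=
  quot_zmodType (@dis_pt_surj e) (@dis_pt_compat e).

Definition orbit_pt (e : Q) (al : Dis) : orbit_zmodType e := dis_pt e al.

Definition orbit_val (e : Q) (a : orbit_zmodType e) : Q := sval (a : dis_orbit e).

(* unfolding these would expose the chosen representatives of the quotient *)
Arguments orbit_pt : simpl never.
Arguments orbit_val : simpl never.

Lemma orbit_val_pt e al : orbit_val (orbit_pt e al) = act al e.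
Proof. by []. Qed.

Lemma orbit_val_inj e : injective (@orbit_val e).
Proof. exact: sval_inj. Qed.

Lemma orbit_ptP e (a : orbit_zmodType e) : exists al, orbit_pt e al = a.
Proof. exact: dis_pt_surj. Qed.

Lemma orbit_ptD e al be : orbit_pt e (al + be) = orbit_pt e al + orbit_pt e be.
Proof. exact: quot_projD. Qed.

Lemma orbit_ptB e al be : orbit_pt e (al - be) = orbit_pt e al - orbit_pt e be.
Proof. exact: quot_projB. Qed.

Lemma orbit_pt0 e : orbit_pt e 0 = 0.
Proof. by []. Qed.

(** By [orbit_map_pt] this is alpha e |-> (eps alpha) e'; written with [delta] it
    visibly depends only on the point alpha e. *)
Definition orbit_map e e' (a : orbit_zmodType e) : orbit_zmodType e' :=
  orbit_pt e' (delta (orbit_val a) e).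

Lemma orbit_map_pt e e' al : orbit_map e' (orbit_pt e al) = orbit_pt e' (eps al).
Proof. by rewrite /orbit_map delta_act. Qed.

Lemma orbit_mapB e e' : zmod_morphism (@orbit_map e e').
Proof.
move=> a b; have [al <-] := orbit_ptP a; have [be <-] := orbit_ptP b.
rewrite -orbit_ptB !orbit_map_pt -orbit_ptB; congr orbit_pt.
by apply: (addIr (eps be)); rewrite -epsD !subrK.
Qed.

Definition orbit_hom e e' : {additive orbit_zmodType e -> orbit_zmodType e'} :=
  HB.pack (@orbit_map e e')
    (GRing.isZmodMorphism.Build _ _ (@orbit_map e e') (@orbit_mapB e e')).

Definition orbit_cst e e' : orbit_zmodType e' := orbit_pt e' (delta e e').

(** By kappa-equivariance (alpha e)(beta e') is delta (alpha e) e' + kappa beta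
    applied to e', and the cocycle delta (alpha e) e' splits at e as
    eps alpha + delta e e'. *)
Lemma orbit_val_sum e e' (a : orbit_zmodType e) (b : orbit_zmodType e') :
  orbit_val (orbit_cst e e' + orbit_hom e e' a + (b - orbit_hom e' e' b)) =
  op (orbit_val a) (orbit_val b).
Proof.
have [al <-] := orbit_ptP a; have [be <-] := orbit_ptP b.
rewrite /= /orbit_cst !orbit_map_pt -orbit_ptB.
rewrite [be - _]subKr -(orbit_ptD e' (delta e e')) -orbit_ptD.
rewrite -(delta_act al e) [delta _ _ + _]addrC delta_chain.
by rewrite !orbit_val_pt actD -[X in act (kappa be) X]opxx kappa_op delta_op.
Qed.

Lemma orbit_hom_M1 e : bijective (fun a => a - orbit_hom e e a).
Proof.
(* on the underlying points this map is L_e *)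
have val_L a : orbit_val (a - orbit_hom e e a) = op e (orbit_val a).
  have := orbit_val_sum (orbit_pt e 0) a.
  rewrite orbit_pt0 raddf0 addr0 /orbit_cst delta_xx orbit_pt0 add0r => ->.
  by rewrite orbit_val_pt act0.
apply: inj_surj_bij => [a b /(congr1 (@orbit_val e))|b].
  by rewrite !val_L => /op_inj /orbit_val_inj.
have [be <-] := orbit_ptP b; set z := ldiv e (act be e).
have z_orb : orbit_val (orbit_pt e (- delta e z + be)) = z.
  rewrite orbit_val_pt actD; apply: (can_inj (actNK (delta e z))).
  by rewrite -actD subrr act0 -{2}[z]opxx delta_op ldivK.
exists (orbit_pt e (- delta e z + be)); apply: orbit_val_inj.
by rewrite val_L z_orb ldivK.
Qed.

Lemma orbit_cst_M2 e : orbit_cst e e = 0.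
Proof. by rewrite /orbit_cst delta_xx. Qed.

Lemma orbit_hom_M3 e1 e2 e2' e3 (a : orbit_zmodType e1) :
  orbit_hom e2 e3 (orbit_hom e1 e2 a) = orbit_hom e2' e3 (orbit_hom e1 e2' a).
Proof. by have [al <-] := orbit_ptP a; rewrite /= !orbit_map_pt. Qed.

Lemma orbit_cst_M4 e1 e2 e3 :
  orbit_hom e2 e3 (orbit_cst e1 e2) =
  orbit_hom e3 e3 (orbit_cst e1 e3 - orbit_cst e2 e3).
Proof.
rewrite /= /orbit_cst -orbit_ptB !orbit_map_pt.
by rewrite -(delta_chain e1 e2 e3) addrK.
Qed.

(** * The mesh of a medial quandle *)

Section Transversal.
Variables (I : Type) (e : I -> Q) (I_nonempty : inhabited I).
Hypothesis e_onto : forall x, exists i al, act al (e i) = x.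
Hypothesis e_inj : forall i j al, act al (e i) = e j -> i = j.

Definition orbit_mesh : affine_mesh I :=
  @AffineMesh I (fun i => orbit_zmodType (e i)) (fun i j => orbit_hom (e i) (e j))
    (fun i j => orbit_cst (e i) (e j)) I_nonempty
    (fun i => @orbit_hom_M1 (e i)) (fun i => orbit_cst_M2 (e i))
    (fun i j j' k => @orbit_hom_M3 (e i) (e j) (e j') (e k))
    (fun i j k => orbit_cst_M4 (e i) (e j) (e k)).

Definition orbit_mesh_val (x : mesh_sum orbit_mesh) : Q := orbit_val (projT2 x).

Lemma orbit_mesh_iso : sum_isomorphism op orbit_mesh_val.
Proof.
split; last first.
  by move=> [i a] [j b]; rewrite -[RHS](orbit_val_sum (projT2 (existT _ i a)) b).
apply: inj_surj_bij => [[i a] [j b]|x]; last first.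
  have [i [al alx]] := e_onto x.
  by exists (existT _ i (orbit_pt (e i) al)).
rewrite /orbit_mesh_val /= => ab; have eq_ij : i = j.
  have [al a_al] := orbit_ptP a; have [be b_be] := orbit_ptP b.
  move: ab; rewrite -a_al -b_be => /= ab.
  apply: (@e_inj i j (- be + al)); rewrite actD.
  by rewrite [act al _]ab; exact: actNK.
move: eq_ij b ab => <- b /orbit_val_inj ->; congr existT.
Qed.

Lemma orbit_mesh_indecomposable : indecomposable orbit_mesh.
Proof.
move=> j; apply/seteqP; split=> // a _ H [[H0 HB] genH].
have HN u : H u -> H (- u) by move=> Hu; rewrite -sub0r; exact: HB.
have HD u v : H u -> H v -> H (u + v).
  by move=> Hu Hv; rewrite -[v]opprK; apply: HB => //; exact: HN.
(* the mesh generators c_ij + phi_ij (alpha e_i), one for each x = alpha e_i *)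
have H_delta x : H (orbit_pt (e j) (delta x (e j))).
  have [i [al <-]] := e_onto x; apply: genH; exists i => //.
  exists (orbit_pt (e i) al) => //=.
  rewrite /orbit_cst orbit_map_pt -[_ + _]orbit_ptD; congr orbit_pt.
  by rewrite -(delta_act al (e i)) addrC delta_chain.
suff H_all g : displacements g ->
    forall al : Dis, sval al = g -> H (orbit_pt (e j) al).
  by have [al <-] := orbit_ptP a; exact: H_all (svalP al) al erefl.
suff H_all' : displacements `<=`
    [set g | exists2 al : Dis, sval al = g & H (orbit_pt (e j) al)].
  by move=> /H_all' [be <- Hbe] al /sval_inj ->.
apply: generated_permutation_ind; first exact: displace_bij.
- move=> _ [b [c ->]]; exists (delta b c) => //.
  rewrite -(delta_chain _ (e j)) [X in H X]orbit_ptD.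
  have -> : delta (e j) c = - delta c (e j).
    by apply/eqP; rewrite -addr_eq0 delta_chain delta_xx.
  by rewrite -sub0r orbit_ptB; apply: HD => //; exact: HB.
- by exists 0 => //; exact: sval_perm_id.
- move=> _ _ [al <- Hal] [be <- Hbe]; exists (al + be); first exact: sval_perm_comp.
  by rewrite [X in H X]orbit_ptD; exact: HD.
- move=> _ h [al <- Hal] gK hK; exists (- al); last first.
    by rewrite -sub0r [X in H X]orbit_ptB; exact: HB.
  apply/funext => x; rewrite -{1}[x]hK; exact: (actNK al (h x)).
Qed.

End Transversal.

Definition dis_orbit_set (x : Q) : set Q := [set y | exists al, act al x = y].

Lemma dis_orbit_set_eq al x : dis_orbit_set (act al x) = dis_orbit_set x.
Proof.
apply/seteqP; split=> [_ [be <-]|_ [be <-]]; first by exists (be + al); rewrite actD.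
by exists (be - al); rewrite actD actNK.
Qed.

Definition dis_orbit_index : Type := {S : set Q | exists x, dis_orbit_set x = S}.

Definition dis_orbit_repr (i : dis_orbit_index) : Q := sval (cid (svalP i)).

Lemma dis_orbit_reprE i : dis_orbit_set (dis_orbit_repr i) = sval i.
Proof. exact: svalP (cid (svalP i)). Qed.

Lemma medial_quandle_mesh :
  exists (I : Type) (M : affine_mesh I) (f : mesh_sum M -> Q),
    indecomposable M /\ sum_isomorphism op f.
Proof.
pose index x : dis_orbit_index := exist _ (dis_orbit_set x) (ex_intro _ x erefl).
have r_onto x : exists i al, act al (dis_orbit_repr i) = x.
  exists (index x); change (dis_orbit_set (dis_orbit_repr (index x)) x).
  by rewrite dis_orbit_reprE; exists 0; exact: act0.
have r_inj i j al : act al (dis_orbit_repr i) = dis_orbit_repr j -> i = j.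
  move=> ij; apply: sval_inj.
  by rewrite -!dis_orbit_reprE -ij dis_orbit_set_eq.
exists dis_orbit_index, (orbit_mesh dis_orbit_repr (inhabits (index q0))).
exists (@orbit_mesh_val _ _ _); split.
  exact: orbit_mesh_indecomposable.
exact: orbit_mesh_iso.
Qed.

End Displacements.

(** * Sums of affine meshes *)

Lemma existT_fibre_inj (I : Type) (P : I -> Type) (i : I) : injective (existT P i).
Proof.
pose I_eq : eqType := HB.pack I (gen_eqMixin I).
by move=> a b; exact: (@existT_inj2 I_eq P i a b).
Qed.

Section MeshSum.
Local Open Scope ring_scope.
Variables (I : Type) (M : affine_mesh I).

Lemma mesh_sum_idem (x : mesh_sum M) : mesh_sum_op x x = x.
Proof.
case: x => i a /=; congr existT.
by rewrite mesh_M2 add0r addrCA subrr addr0.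
Qed.

Lemma mesh_sum_medial : medial (@mesh_sum_op I M).
Proof.
move=> [i a] [j b] [k c] [l d] /=; congr existT.
rewrite !(raddfD, raddfN) /= !mesh_M4 !(raddfD, raddfN) /=.
rewrite (mesh_M3 j k l a) (mesh_M3 j l l b) (mesh_M3 k l l c).
rewrite mesh_M2 raddf0 !oppr0 !addr0.
set D := d - _; set E := - _ - - _.
(* the twelve terms are now symmetric under exchanging (j, b) and (k, c) *)
by rewrite [LHS](AC (1*(3*2)*(3*3)) (7*(2*10*4*(8*11))*(1*5*9*(3*6*12)))).
Qed.

Lemma mesh_sum_quandle : quandle (@mesh_sum_op I M).
Proof.
split=> [x|x y z|[i a] [j b]]; first exact: mesh_sum_idem.
  by rewrite -{1}[x]mesh_sum_idem mesh_sum_medial.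
have [g gK hK] := mesh_M1 M j.
exists (existT _ j (g (b - (mesh_cst M i j + mesh_hom M i j a)))); split.
  by rewrite /= hK addrC subrK.
move=> [k c] ab; have eq_kj : k = j := congr1 (@projT1 _ _) ab.
subst k; have /= <- := existT_fibre_inj ab; congr existT.
by rewrite addrAC subrr add0r gK.
Qed.

End MeshSum.

Lemma medial_quandle_transfer (P Q : Type) (opP : P -> P -> P) (op : Q -> Q -> Q)
    (f : P -> Q) :
    bijective f -> (forall x y, f (opP x y) = op (f x) (f y)) ->
  medial_quandle opP -> medial_quandle op.
Proof.
move=> [h fK hK] fM [[idem distl div] med].
have opE x y : op x y = f (opP (h x) (h y)) by rewrite fM !hK.
split; first split.
- by move=> x; rewrite opE idem hK.
- by move=> x y z; rewrite !opE !fK distl.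
- move=> x y; have [u [xu uniq_u]] := div (h x) (h y).
  exists (f u); split; first by rewrite opE fK xu hK.
  by move=> v; rewrite opE => /(canRL fK) /uniq_u ->.
- by move=> x y u v; rewrite !opE !fK med.
Qed.

(** * Orbits of a sum *)

Section Orbits.
Local Open Scope ring_scope.
Variables (Q : Type) (op : Q -> Q -> Q).
Variables (I : Type) (M : affine_mesh I) (f : mesh_sum M -> Q).
Hypotheses (M_indec : indecomposable M) (f_iso : sum_isomorphism op f).

Lemma sum_medial_quandle : medial_quandle op.
Proof.
have [f_bij fM] := f_iso; apply: medial_quandle_transfer f_bij fM _.
by split; [exact: mesh_sum_quandle | exact: mesh_sum_medial].
Qed.

Let elt (i : I) (a : mesh_grp M i) : Q := f (existT _ i a).

Lemma elt_op i j (a : mesh_grp M i) (b : mesh_grp M j) :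
  op (elt a) (elt b) =
  elt (mesh_cst M i j + mesh_hom M i j a + (b - mesh_hom M j j b)).
Proof. by rewrite /elt -(proj2 f_iso). Qed.

Lemma left_translation_bij g : range (left_translation op) g -> bijective g.
Proof.
have op_mq := sum_medial_quandle.
by move=> [a _ <-]; exists (ldiv op_mq a); [exact: opK | exact: ldivK].
Qed.

Lemma LMlt_group : permutation_group (LMlt op).
Proof. exact: generated_permutation_group left_translation_bij. Qed.

Lemma LMlt_component g i (a : mesh_grp M i) :
  LMlt op g -> exists b : mesh_grp M i, g (elt a) = elt b.
Proof.
move=> Lg; move: g Lg i a.
apply: generated_permutation_ind; first exact: left_translation_bij.
- move=> _ [x _ <-] i a; have [h _ hK] := proj1 f_iso.
  case hx: (h x) => [j b]; have -> : x = elt b by rewrite /elt -hx hK.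
  by eexists; exact: elt_op.
- by move=> i a; exists a.
- move=> g h gP hP i a /=; have [b ->] := hP i a; exact: gP.
- move=> g h gP gK hK i a; have [k _ kK] := proj1 f_iso.
  (* the preimage of a lies in some component, which g preserves *)
  case hx: (k (h (elt a))) => [j b].
  have h_a : h (elt a) = elt b by rewrite /elt -hx kK.
  have [c gb] := gP j b; have a_c : elt a = elt c by rewrite -gb -h_a hK.
  have eq_ji : j = i := esym (congr1 (@projT1 _ _) (bij_inj (proj1 f_iso) a_c)).
  by move: b {hx c gb a_c} h_a; rewrite eq_ji => b h_a; exists b.
Qed.

(** The additions available in LMlt(Q) form a subgroup of A_j, and the addition
    of c_ij + phi_ij(a) is L_a L_0^-1, where 0 is the zero of A_j. *)
Lemma LMlt_translation j (d : mesh_grp M j) :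
  exists2 g, LMlt op g & forall b : mesh_grp M j, g (elt b) = elt (b + d).
Proof.
have [G_bij G1 GM GV] := LMlt_group; have op_mq := sum_medial_quandle.
have GL a : LMlt op (op a) by apply: sub_gen_smallest; exists a.
have : [set: mesh_grp M j] d by [].
rewrite -(M_indec j) => /(_ [set d : mesh_grp M j | exists2 g, LMlt op g &
  forall b : mesh_grp M j, g (elt b) = elt (b + d)]); apply; split; first split.
- by exists id => // b; rewrite addr0.
- move=> u v [g Gg gu] [h Gh hv]; have [k [hK kK]] := bijective_can2 (G_bij h Gh).
  exists (g \o k); first by apply: GM => //; exact: GV Gh hK kK.
  move=> b /=; have -> : k (elt b) = elt (b - v) by rewrite -{1}[b](subrK v) -hv hK.
  by rewrite gu addrAC addrA.
- move=> _ [i _ [a _ <-]];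
  exists (op (elt a) \o ldiv op_mq (elt (0 : mesh_grp M j))).
    by apply: GM => //; apply: GV (opK _ _) (ldivK _ _).
  move=> b /=; have [h _ hK] := mesh_M1 M j.
  have -> : elt b = op (elt (0 : mesh_grp M j)) (elt (h b)).
    by rewrite elt_op mesh_M2 raddf0 !add0r hK.
  by rewrite opK elt_op hK addrC.
Qed.

Lemma orbit_of_elt i (a : mesh_grp M i) :
  orbit_of op (elt a) = f @` mesh_component M i.
Proof.
apply/seteqP; split=> [_ [g Gg <-]|_ [_ [b _ <-] <-]].
  have [b ->] := LMlt_component a Gg.
  by exists (existT _ i b) => //; exists b.
have [g Gg gP] := LMlt_translation (b - a).
by exists g => //; rewrite gP addrC subrK.
Qed.

Lemma orbits_sum : orbits op = range (fun i : I => f @` mesh_component M i).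
Proof.
apply/seteqP; split=> [_ [x _ <-]|_ [i _ <-]]; last first.
  by exists (elt (0 : mesh_grp M i)) => //; exact: orbit_of_elt.
have [h _ hK] := proj1 f_iso; case hx: (h x) => [i a].
by exists i => //; rewrite -(orbit_of_elt a) /elt -hx hK.
Qed.

End Orbits.

Theorem theorem3p14 (Q : Type) (op : Q -> Q -> Q) (Q_nonempty : inhabited Q) :
  (medial_quandle op <->
     exists (I : Type) (M : affine_mesh I) (f : mesh_sum M -> Q),
       indecomposable M /\ sum_isomorphism op f)
  /\
  (forall (I : Type) (M : affine_mesh I) (f : mesh_sum M -> Q),
     indecomposable M -> sum_isomorphism op f ->
     orbits op = range (fun i : I => f @` mesh_component M i)).
Proof.
split; last by move=> I M f M_indec f_iso; exact: orbits_sum.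
split=> [op_mq|[I [M [f [_ f_iso]]]]]; last exact: sum_medial_quandle f_iso.
by case: Q_nonempty => q0; exact: medial_quandle_mesh op_mq q0.
Qed.
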